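(* Let $a,b\ge 0$ with $0<1-b+a<1$, let $\alpha$ be a real number, and let $\beta=b-a$. Suppose that the function $$f_{\alpha,\beta}(x)=(x+a)^{\alpha}\left[\psi(x+b)-\psi(x+a)-\frac{\beta}{x+a}\right]$$ is completely monotone on $(-a,\infty)$. If $-1-2a+2b>0$, then $\alpha<2$.
   Context: A function $f:I\to\mathbb{R}$ on an interval $I\subseteq\mathbb{R}$ is called completely monotone if it has derivatives of all orders and $(-1)^n f^{(n)}(x)\ge 0$ for all $n=0,1,2,\ldots$ and all $x\in I$. Here $\psi(z)=\Gamma'(z)/\Gamma(z)$ ($z\ne 0,-1,-2,\ldots$) is the digamma function. *)

(* Defs.v *)
From HB Require Import structures.
From mathcomp Require Import all_boot all_order all_algebra.
From mathcomp Require Import all_classical all_reals all_analysis.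

Set Implicit Arguments.
Unset Strict Implicit.
Unset Printing Implicit Defensive.

Import Order.TTheory GRing.Theory Num.Theory.
Import numFieldNormedType.Exports.

Local Open Scope classical_set_scope.
Local Open Scope ring_scope.

(* Euler's integral of the second kind. It converges, and hence is the Gamma
   function, exactly for [0 < x]; values at [x <= 0] are meaningless. *)
Definition Gamma (R : realType) (x : R) : R :=
  \int[lebesgue_measure]_(t in `]0, +oo[) (t `^ (x - 1) * expR (- t)).

(* Meaningful for [0 < x] only, like [Gamma]. *)
Definition digamma (R : realType) (x : R) : R :=
  derive1 (@Gamma R) x / Gamma x.

(* [derivable] and [derive1n] are two-sided, so this is the usual notion for an
   open interval [I]; it then depends only on the values of [f] on [I]. *)
Definition completely_monotone (R : realType) (I : interval R) (f : R -> R) :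
    Prop :=
  forall (n : nat) (x : R), x \in I ->
    derivable (derive1n n f) x 1 /\ 0 <= (-1) ^+ n * derive1n n f x.

(* Main.v *)
(** Put [t = x + a] and [beta = b - a]. Since [digamma (t + 1) = digamma t + 1 / t],
    the function equals
    [t^(alpha - 1) * (1 - beta + t * (digamma (t + beta) - digamma (t + 1)))],
    and the difference of digammas stays bounded as [t] tends to [0]. Hence for
    [1 < alpha] the function tends to [0] at the left end of the interval, while
    it is positive near that end. A nonincreasing function cannot do this. *)

Require Import Defs.
From mathcomp Require Import all_boot all_order all_algebra.
From mathcomp Require Import all_classical all_reals all_analysis.
From mathcomp Require Import measurable_realfun ring lra.
Import Order.TTheory GRing.Theory Num.Theory.
Import numFieldNormedType.Exports.
Local Open Scope ring_scope.
Local Open Scope classical_set_scope.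

Local Notation mu := lebesgue_measure.

(** * Integrals of derivatives over the positive half-line *)

(** [f] may be singular at 0, so the fundamental theorem is applied on closed half-lines that
    exhaust the open one. Nonnegativity lets the integrals pass to the limit by monotone
    convergence. *)
Lemma ge0_FTC_gt0 (R : realType) (f F : R -> R) (l0 l1 : R) :
  (forall u : R, 0 < u -> 0 <= f u) ->
  {in `]0, +oo[%R, continuous f} ->
  (forall u : R, 0 < u -> is_derive u 1 F (f u)) ->
  F u @[u --> 0^'+] --> l0 -> F u @[u --> +oo%R] --> l1 ->
  (\int[mu]_(u in `]0%R, +oo[) (f u)%:E = (l1 - l0)%:E)%E.
Proof.
move=> f0 cf dF F0 F1.
have mf : measurable_fun (`]0, +oo[ : set R) f.
  by apply: open_continuous_measurable_fun => //; apply/in_continuous_mksetP.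
(* The shift to [n.+1] keeps every left endpoint positive, and [0 +] is the shape in which
   [itvoyEbigcup] writes the exhaustion. *)
pose I n : set R := `[0 + n.+1%:R^-1, +oo[.
have S n : I n `<=` (`]0, +oo[ : set R).
  by move=> u; rewrite /I/= !in_itv/= !andbT add0r; apply: lt_le_trans.
have ndI : {homo I : m n / (m <= n)%N >-> (m <= n)%O}.
  move=> m n mn; rewrite subsetEset => u; rewrite /I/= !in_itv/= !andbT !add0r.
  by apply: le_trans; rewrite lef_pV2 ?posrE// ler_nat ltnS.
have mI n : measurable (I n) by exact: measurable_itv.
have mfI n : measurable_fun (I n) (EFin \o f).
  by apply/measurable_EFinP; apply: measurable_funS mf.
have fI0 n u : I n u -> (0 <= (EFin \o f) u)%E.
  by move=> /S /=; rewrite in_itv/= andbT lee_fin; exact: f0.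
have /cvg_lim IfE := @ge0_nondecreasing_set_cvg_integral _ (measurableTypeR R) R
  I (EFin \o f) mu ndI mI mfI fI0.
rewrite itvoyEbigcup -[LHS]IfE//; apply/cvg_lim => //.
have E n : (\int[mu]_(u in I n) (f u)%:E
    = (l1 - F n.+1%:R^-1)%:E)%E.
  have n0 : 0 < n.+1%:R^-1 :> R by [].
  rewrite /I add0r (@ge0_continuous_FTC2y _ f F _ l1)// ?EFinB//.
  + by move=> u nu; apply: f0; apply: lt_le_trans nu.
  + have Cf (u : R) : 0 < u -> f x @[x --> u] --> f u.
      by move=> u0; apply: cf; rewrite in_itv/= u0.
    apply/continuous_within_itvcyP; split.
      move=> u; rewrite in_itv/= andbT => nu.
      by apply: Cf; apply: lt_trans nu.
    by apply: cvg_at_right_filter; exact: Cf.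
  + by move=> u nu; apply: ex_derive; apply: dF; apply: lt_trans nu.
  + apply: cvg_at_right_filter; apply: differentiable_continuous.
    by apply/derivable1_diffP; apply: ex_derive; exact: dF.
  + move=> u; rewrite in_itv/= andbT => nu; rewrite derive1E.
    by have [_ ->] := dF _ (lt_trans n0 nu).
under eq_fun do rewrite E.
apply: cvg_EFin; first exact: nearW.
apply: cvgB; first exact: cvg_cst.
move/cvg_at_rightP : F0; apply; split => //.
exact: cvg_harmonic.
Qed.

(** A primitive with finite limits at both ends serves as an integrability test: the integral has
    the finite value [l1 - l0]. *)
Lemma ge0_FTC_gt0_integrable (R : realType) (f F : R -> R) (l0 l1 : R) :
  (forall u : R, 0 < u -> 0 <= f u) ->
  {in `]0, +oo[%R, continuous f} ->
  (forall u : R, 0 < u -> is_derive u 1 F (f u)) ->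
  F u @[u --> 0^'+] --> l0 -> F u @[u --> +oo%R] --> l1 ->
  mu.-integrable (`]0, +oo[ : set R) (EFin \o f).
Proof.
move=> f0 cf dF F0 F1; apply/integrableP; split.
  apply/measurable_EFinP; apply: open_continuous_measurable_fun => //.
  exact/in_continuous_mksetP.
rewrite (_ : (\int[mu]_(u in _) _)%E = (l1 - l0)%:E) ?ltry//.
rewrite -(@ge0_FTC_gt0 R f F)//; apply: eq_integral => u.
by rewrite inE/= in_itv/= andbT => u0; rewrite ger0_norm// f0.
Qed.

(** Extension to integrands of variable sign: [f + h] and [h] are nonnegative with known primitives,
    and subtracting their integrals leaves that of [f]. *)
Lemma dominated_FTC_gt0 (R : realType) (f F h H : R -> R) (l0 l1 m0 m1 : R) :
  (forall u : R, 0 < u -> `|f u| <= h u) ->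
  {in `]0, +oo[%R, continuous f} -> {in `]0, +oo[%R, continuous h} ->
  (forall u : R, 0 < u -> is_derive u 1 F (f u)) ->
  (forall u : R, 0 < u -> is_derive u 1 H (h u)) ->
  F u @[u --> 0^'+] --> l0 -> F u @[u --> +oo%R] --> l1 ->
  H u @[u --> 0^'+] --> m0 -> H u @[u --> +oo%R] --> m1 ->
  \int[mu]_(u in `]0%R, +oo[) f u = l1 - l0.
Proof.
move=> fh cf ch dF dH F0 F1 H0 H1.
have h0 u : 0 < u -> 0 <= h u by move=> /fh; apply: le_trans.
have ih := ge0_FTC_gt0_integrable _ _ _ _ _ h0 ch dH H0 H1.
have if_ : mu.-integrable (`]0, +oo[ : set R) (EFin \o f).
  apply: (le_integrable _ _ _ ih) => //.
    apply/measurable_EFinP; apply: open_continuous_measurable_fun => //.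
    exact/in_continuous_mksetP.
  move=> u /=; rewrite in_itv/= andbT => u0; rewrite lee_fin.
  by rewrite (le_trans (fh _ u0))// ler_norm.
have : \int[mu]_(u in `]0%R, +oo[) (f u + h u) = (l1 + m1) - (l0 + m0).
  rewrite [LHS]/Rintegral -[RHS]/(fine (l1 + m1 - (l0 + m0))%:E); congr fine.
  apply: (@ge0_FTC_gt0 R (f \+ h) (F + H)).
  - move=> u /fh /=; rewrite ler_norml => /andP[+ _].
    by rewrite -subr_ge0 opprK addrC.
  - by move=> u u0; apply: continuousD; [exact: cf|exact: ch].
  - by move=> u u0; apply: is_deriveD; [exact: dF|exact: dH].
  - exact: cvgD.
  - exact: cvgD.
rewrite RintegralD// [X in _ + X](_ : _ = m1 - m0).
  by move=> /(canRL (addrK _)) ->; ring.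
by rewrite [LHS]/Rintegral (ge0_FTC_gt0 _ _ _ _ _ h0 ch dH H0 H1).
Qed.

(** * The Gamma integral *)

(** Raise [u / x <= expR (u / x)], a consequence of [1 + v <= expR v], to the power [x]. *)
Lemma powR_le_expR (R : realType) (x u : R) :
  0 < x -> 0 <= u -> u `^ x <= x `^ x * expR u.
Proof.
move=> x0 u0; have x_n0 := lt0r_neq0 x0.
rewrite -[u in expR u](divfK x_n0) expRM -powRM ?expR_ge0 ?(ltW x0)//.
apply: ge0_ler_powR; rewrite ?nnegrE ?mulr_ge0 ?expR_ge0 ?(ltW x0)//.
rewrite -ler_pdivrMl// mulrC; apply: le_trans (expR_ge1Dx _).
by rewrite lerDr.
Qed.

Lemma continuous_powR (R : realType) (x u : R) :
  0 < u -> {for u, continuous (fun v => v `^ x)}.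
Proof.
move=> u0; apply: differentiable_continuous; apply/derivable1_diffP.
by apply: ex_derive; exact: is_derive1_powR.
Qed.

Lemma cvg_powR_pinfty (R : realType) (x : R) :
  0 < x -> u `^ x @[u --> +oo%R] --> +oo%R.
Proof.
move=> x0; apply/cvgryPge => A; near=> u.
(* The threshold for [u] is the root of [A] of order [x]; truncating at 0 avoids the default value
   of [powR] at negative bases. *)
have A0 : 0 <= Num.max A 0 by rewrite le_max lexx orbT.
apply: (@le_trans _ _ ((Num.max A 0 `^ x^-1) `^ x)).
  by rewrite -powRrM mulVf ?gt_eqF// powRr1// le_max lexx.
apply: ge0_ler_powR; rewrite ?nnegrE ?powR_ge0 ?(ltW x0)//.
Unshelve. all: end_near. Qed.

(** One spare power suffices: [u^(x+1) <= C * expR u] gives [u^x * expR (- u) <= C / u]. *)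
Lemma cvg_powR_expRN (R : realType) (x : R) :
  0 < x -> u `^ x * expR (- u) @[u --> +oo%R] --> (0 : R).
Proof.
move=> x0; pose C := (x + 1) `^ (x + 1).
apply: (@squeeze_cvgr _ _ _ _ (cst 0) (fun u => C * u^-1)).
- near=> u; have u0 : 0 < u by near: u; apply: nbhs_pinfty_gt; rewrite num_real.
  rewrite /= mulr_ge0 ?powR_ge0 ?expR_ge0//= expRN ler_pdivrMr ?expR_gt0//.
  rewrite mulrAC ler_pdivlMr// [X in X <= _](_ : _ = u `^ (x + 1)); last first.
    by rewrite powRD ?(gt_eqF u0) ?implybT// powRr1// ltW.
  by apply: powR_le_expR; rewrite ?addr_gt0 ?(ltW u0).
- exact: cvg_cst.
- rewrite -[X in _ --> X](mulr0 C); apply: cvgMr.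
  by apply/gtr0_cvgV0 => //; apply: nbhs_pinfty_gt; rewrite num_real.
Unshelve. all: end_near. Qed.

(* The weight [(1 + u^x)^-2] is what makes [u^(x-1)] integrable with the
   explicit primitive [- (x (1 + u^x))^-1]; [(1 + u^x)^2 <= 2 + 2 u^(2x)] and
   [powR_le_expR] account for the constant. *)
Definition gamma_bound (R : realType) (x u : R) : R :=
  (2 + 2 * (2 * x) `^ (2 * x)) * (u `^ (x - 1) / (1 + u `^ x) ^+ 2).

Definition gamma_bound_primitive (R : realType) (x u : R) : R :=
  - ((2 + 2 * (2 * x) `^ (2 * x)) / x) * (1 + u `^ x)^-1.

Lemma gamma_integrand_le (R : realType) (x u : R) : 0 < x -> 0 < u ->
  u `^ (x - 1) * expR (- u) <= gamma_bound _ x u.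
Proof.
move=> x0 u0; rewrite /gamma_bound mulrCA ler_wpM2l ?powR_ge0//.
have p0 : 0 <= u `^ x by exact: powR_ge0.
rewrite expRN ler_pdivlMr; last by rewrite exprn_gt0// ltr_wpDr.
rewrite mulrC ler_pdivrMr ?expR_gt0//.
have : (u `^ x) ^+ 2 <= (2 * x) `^ (2 * x) * expR u.
  rewrite -powR_mulrn// -powRrM mulrC; apply: powR_le_expR; last exact: ltW.
  by rewrite mulr_gt0.
have : 1 <= expR u by rewrite -expR0 ler_expR ltW.
have : 0 <= (1 - u `^ x) ^+ 2 by exact: sqr_ge0.
set e := expR u; set v := u `^ x; set K := _ `^ _.
by move=> *; nra.
Qed.

Lemma gamma_bound_ge0 (R : realType) (x u : R) : 0 <= gamma_bound _ x u.
Proof.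
rewrite /gamma_bound mulr_ge0 ?addr_ge0 ?mulr_ge0 ?powR_ge0//.
by rewrite invr_ge0 sqr_ge0.
Qed.

Lemma continuous_gamma_bound (R : realType) (x u : R) :
  0 < u -> {for u, continuous (gamma_bound _ x)}.
Proof.
move=> u0; have p0 : 0 <= u `^ x by exact: powR_ge0.
apply: cvgMr; apply: cvgM; first exact: continuous_powR.
apply: cvgV; first by rewrite expf_neq0// gt_eqF// ltr_wpDr.
have c1 : (1 + v `^ x) @[v --> u] --> 1 + u `^ x.
  by apply: cvgD; [exact: cvg_cst|exact: continuous_powR].
by rewrite expr2; under eq_fun do rewrite expr2; apply: cvgM.
Qed.

Lemma is_derive_gamma_bound (R : realType) (x u : R) : 0 < x -> 0 < u ->
  is_derive u 1 (gamma_bound_primitive _ x) (gamma_bound _ x u).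
Proof.
move=> x0 u0; have p0 : 0 <= u `^ x by exact: powR_ge0.
pose g (v : R) : R := 1 + v `^ x.
have n0 : g u != 0 by rewrite gt_eqF// ltr_wpDr.
have d1 : is_derive u 1 g (0 + x * u `^ (x - 1)).
  by apply: is_deriveD; exact: is_derive1_powR.
have d2 := is_deriveV n0 d1.
have d3 := is_deriveZ (- ((2 + 2 * (2 * x) `^ (2 * x)) / x)) d2.
apply: (is_derive_eq d3).
rewrite /GRing.scale/= /gamma_bound add0r /g; field.
by rewrite (gt_eqF x0) n0.
Qed.

Lemma cvg_gamma_bound0 (R : realType) (x : R) : 0 < x ->
  gamma_bound_primitive _ x u @[u --> 0^'+] -->
    - ((2 + 2 * (2 * x) `^ (2 * x)) / x).
Proof.
move=> x0; rewrite -[X in _ --> X]mulr1; apply: cvgMr.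
rewrite -[X in _ --> X]invr1; apply: cvgV => //.
rewrite -[X in _ --> X]addr0; apply: cvgD; first exact: cvg_cst.
exact: powR_cvg0.
Qed.

Lemma cvg_gamma_bound_pinfty (R : realType) (x : R) : 0 < x ->
  gamma_bound_primitive _ x u @[u --> +oo%R] --> (0 : R).
Proof.
move=> x0; rewrite -[X in _ --> X](mulr0 (- ((2 + 2 * (2 * x) `^ (2 * x)) / x))).
apply: cvgMr; apply/gtr0_cvgV0.
  by near=> u; rewrite ltr_wpDr// powR_ge0.
apply/cvgryPge => A; near=> u.
apply: (@le_trans _ _ (u `^ x)); last by rewrite lerDr.
by near: u; move: A; apply/cvgryPge; exact: cvg_powR_pinfty.
Unshelve. all: end_near. Qed.

Lemma continuous_gamma_integrand (R : realType) (x u : R) :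
  0 < u -> {for u, continuous (fun v => v `^ x * expR (- v))}.
Proof.
move=> u0; apply: cvgM; first exact: continuous_powR.
apply: continuous_comp; last exact: continuous_expR.
exact: continuousN.
Qed.

(** Comparison with [gamma_bound] handles the singularity at 0 and the tail at once. *)
Lemma integrable_Gamma (R : realType) (x : R) : 0 < x ->
  mu.-integrable (`]0, +oo[ : set R)
    (EFin \o (fun u => u `^ (x - 1) * expR (- u))).
Proof.
move=> x0.
have gb0 (u : R) : 0 < u -> 0 <= gamma_bound R x u by rewrite gamma_bound_ge0.
have cgb : {in `]0, +oo[%R, continuous (gamma_bound R x)}.
  by move=> u; rewrite in_itv/= andbT; exact: continuous_gamma_bound.
have igb := ge0_FTC_gt0_integrable _ _ _ _ _ gb0 cgb
  (fun u => is_derive_gamma_bound _ _ u x0) (cvg_gamma_bound0 _ _ x0)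
  (cvg_gamma_bound_pinfty _ _ x0).
apply: (le_integrable _ _ _ igb) => //.
- apply/measurable_EFinP; apply: open_continuous_measurable_fun => // u.
  rewrite inE/= in_itv/= andbT; exact: continuous_gamma_integrand.
- move=> u /=; rewrite in_itv/= andbT lee_fin => u0.
  rewrite ger0_norm ?mulr_ge0 ?powR_ge0 ?expR_ge0//.
  by rewrite ger0_norm ?gamma_bound_ge0//; exact: gamma_integrand_le.
Qed.

Lemma integrable_GammaZ (R : realType) (k x : R) : 0 < x ->
  mu.-integrable (`]0, +oo[ : set R)
    (EFin \o (fun u => k * (u `^ (x - 1) * expR (- u)))).
Proof.
move=> x0; rewrite (_ : EFin \o _ =
  (fun v => k%:E * (EFin \o (fun u => u `^ (x - 1) * expR (- u))%R) v)%E).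
  by apply: integrableZl => //; exact: integrable_Gamma.
by apply/funext => u /=; rewrite EFinM.
Qed.

Lemma is_derive_gamma_integrand (R : realType) (x u : R) : 0 < u ->
  is_derive u 1 (fun v => v `^ x * expR (- v))
    (x * (u `^ (x - 1) * expR (- u)) - u `^ x * expR (- u)).
Proof.
move=> u0; have d1 := is_derive1_powR x u0.
have d2 : is_derive u 1 (expR \o -%R) (expR (- u) * - 1).
  exact: is_derive1_comp.
apply: (is_derive_eq (is_deriveM d1 d2)).
by rewrite /GRing.scale/=; ring.
Qed.

(** Integration by parts: [F] vanishes at both ends, so the integral of its derivative [f] is 0.
    Since [f] changes sign, it is dominated by [h], a combination of two [gamma_bound]s with
    explicit primitive [H]. *)
Lemma GammaD1 (R : realType) (x : R) : 0 < x -> Gamma (x + 1) = x * Gamma x.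
Proof.
move=> x0; have x10 : 0 < x + 1 by rewrite addr_gt0.
pose f (u : R) := x * (u `^ (x - 1) * expR (- u)) -
  u `^ (x + 1 - 1) * expR (- u).
pose F (u : R) := u `^ x * expR (- u).
pose h (u : R) := x * gamma_bound R x u + gamma_bound R (x + 1) u.
pose H (u : R) :=
  x * gamma_bound_primitive R x u + gamma_bound_primitive R (x + 1) u.
have xE : x + 1 - 1 = x by rewrite addrK.
have fh : forall u : R, 0 < u -> `|f u| <= h u.
  move=> u u0; apply: (le_trans (ler_normB _ _)).
  rewrite !ger0_norm ?mulr_ge0 ?powR_ge0 ?expR_ge0 ?(ltW x0)//.
  by apply: lerD; rewrite ?ler_pM2l//; exact: gamma_integrand_le.
have cf : {in `]0, +oo[%R, continuous f}.
  move=> u; rewrite in_itv/= andbT => u0.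
  apply: cvgB; last exact: continuous_gamma_integrand.
  by apply: cvgMr; exact: continuous_gamma_integrand.
have ch : {in `]0, +oo[%R, continuous h}.
  move=> u; rewrite in_itv/= andbT => u0.
  apply: cvgD; last exact: continuous_gamma_bound.
  by apply: cvgMr; exact: continuous_gamma_bound.
have dF : forall u : R, 0 < u -> is_derive u 1 F (f u).
  by move=> u u0; rewrite /f xE; exact: is_derive_gamma_integrand.
have dH : forall u : R, 0 < u -> is_derive u 1 H (h u).
  move=> u u0; have d1 := is_deriveZ x (is_derive_gamma_bound _ _ _ x0 u0).
  exact: (is_deriveD d1 (is_derive_gamma_bound _ _ _ x10 u0)).
have F0 : F u @[u --> 0^'+] --> (0 : R).
  rewrite -[X in _ --> X](mul0r (expR (- 0))); apply: cvgM.
    exact: powR_cvg0.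
  apply: cvg_at_right_filter; apply: continuous_comp.
    exact: continuousN.
  exact: continuous_expR.
have F1 : F u @[u --> +oo%R] --> (0 : R).
  exact: cvg_powR_expRN.
have H0 : H u @[u --> 0^'+] --> x * - ((2 + 2 * (2 * x) `^ (2 * x)) / x) +
      - ((2 + 2 * (2 * (x + 1)) `^ (2 * (x + 1))) / (x + 1)).
  by apply: cvgD; [apply: cvgMr|]; exact: cvg_gamma_bound0.
have H1 : H u @[u --> +oo%R] --> x * 0 + 0.
  by apply: cvgD; [apply: cvgMr|]; exact: cvg_gamma_bound_pinfty.
have := dominated_FTC_gt0 _ _ _ _ _ _ _ _ _ fh cf ch dF dH F0 F1 H0 H1.
rewrite subrr /f RintegralB//; last 2 first.
- exact: integrable_GammaZ.
- exact: integrable_Gamma.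
rewrite RintegralZl//; last exact: integrable_Gamma.
by move/eqP; rewrite subr_eq0 => /eqP.
Qed.

(** * Bounds on Gamma and its derivative *)

(** For [u >= 1] the logarithm costs one power of [u]. For [u < 1] it costs [u^(-m) / m], and
    [2 * m <= x] leaves an exponent of at least [m - 1], still integrable at 0. The form [r + 1 - 1]
    matches the Gamma integrand at [r + 1]. *)
Lemma norm_ln_powR_le (R : realType) (m r x u : R) :
  0 < m -> 2 * m <= x -> x <= r -> 0 < u ->
  `|ln u| * u `^ (x - 1) <= m^-1 * u `^ (m - 1) + u `^ (r + 1 - 1).
Proof.
move=> m0 mx xr u0; have un0 := lt0r_neq0 u0.
have [u1|u1] := leP 1 u.
  rewrite ger0_norm ?ln_ge0// -[leLHS]add0r lerD ?mulr_ge0 ?powR_ge0//.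
    by rewrite invr_ge0 ltW.
  apply: (@le_trans _ _ (u * u `^ (x - 1))).
    by rewrite ler_wpM2r ?powR_ge0// ltW// ln_sublinear.
  rewrite -[u in u * _]powRr1 ?(ltW u0)// -powRD ?un0 ?implybT//.
  by apply: ler_powR => //; lra.
rewrite ltr0_norm ?ln_lt0 ?u0// -[leLHS]addr0 lerD ?powR_ge0//.
have -> : - ln u = m^-1 * ln (u `^ (- m)).
  by rewrite ln_powR mulNr mulrN mulKf ?gt_eqF.
rewrite -mulrA ler_pM2l ?invr_gt0//.
apply: (@le_trans _ _ (u `^ (- m) * u `^ (x - 1))).
  by rewrite ler_wpM2r ?powR_ge0// ltW// ln_sublinear// powR_gt0.
rewrite -powRD ?un0 ?implybT//.
by apply: ger_powR; [rewrite u0 ltW|lra].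
Qed.

Lemma is_derive_gamma_integrand_param (R : realType) (x u : R) : 0 < u ->
  is_derive x 1 (fun y => u `^ (y - 1) * expR (- u))
    (ln u * u `^ (x - 1) * expR (- u)).
Proof.
move=> u0; pose g (y : R) : R := ln u * (y - 1).
have -> : (fun y => u `^ (y - 1) * expR (- u)) =
          expR (- u) *: (expR \o g).
  apply/funext => y; rewrite -[RHS]/(expR (- u) * expR (ln u * (y - 1))).
  by rewrite /powR gt_eqF// [(y - 1) * _]mulrC [LHS]mulrC.
have d1 : is_derive x 1 g (ln u).
  apply: (is_derive_eq (is_deriveZ (ln u)
    (is_deriveB (is_derive_id x 1) (is_derive_cst (1 : R) x 1)))).
  by rewrite subr0 /GRing.scale/= mulr1.
have d2 := is_derive1_comp (is_derive_expR (g x)) d1.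
apply: (is_derive_eq (is_deriveZ (expR (- u)) d2)).
by rewrite /GRing.scale/= /g /powR gt_eqF// [(x - 1) * _]mulrC; ring.
Qed.

(** A majorant for the parameter derivative of the Gamma integrand, uniform over parameters between
    [2 * m] and [r]. It combines the Gamma integrands at [m] and [r + 1], which makes it
    integrable. *)
Definition gamma_deriv_bound (R : realType) (m r u : R) : R :=
  m^-1 * (u `^ (m - 1) * expR (- u)) + u `^ (r + 1 - 1) * expR (- u).

Lemma integrable_gamma_deriv_bound (R : realType) (m r : R) : 0 < m -> 0 < r ->
  mu.-integrable (`]0, +oo[ : set R) (EFin \o gamma_deriv_bound R m r).
Proof.
move=> m0 r0; have r10 : 0 < r + 1 by rewrite addr_gt0.
rewrite (_ : EFin \o _ = (
   (EFin \o (fun u => m^-1 * (u `^ (m - 1) * expR (- u)))%R) \+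
   (EFin \o (fun u => u `^ (r + 1 - 1) * expR (- u))%R))%E).
  by apply: integrableD => //; [exact: integrable_GammaZ|exact: integrable_Gamma].
by apply/funext => u /=; rewrite -EFinD.
Qed.

(** Differentiation under the integral sign. The majorant with [m = l / 2] both justifies it and,
    once integrated, gives a bound [M] independent of [x]. *)
Lemma Gamma_deriv_bounded (R : realType) (l r : R) : 0 < l ->
  exists M : R, forall x, l < x -> x < r ->
    derivable (@Gamma R) x 1 /\ `|derive1 (@Gamma R) x| <= M.
Proof.
move=> l0; pose m := l / 2; have m0 : 0 < m by rewrite divr_gt0.
have ml : 2 * m = l by rewrite /m; field.
exists (\int[mu]_(u in `]0%R, +oo[) gamma_deriv_bound R m r u) => x lx xr.
have r0 : 0 < r by rewrite (lt_trans _ xr)// (lt_trans _ lx).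
pose f (y u : R) : R := u `^ (y - 1) * expR (- u).
have d1E y u : 0 < u -> partial1of2 f y u = ln u * u `^ (y - 1) * expR (- u).
  move=> u0; rewrite partial1of2E.
  by have [_ ->] := is_derive_gamma_integrand_param _ y _ u0.
have fle y u : l < y -> y < r -> 0 < u ->
    `|ln u * u `^ (y - 1) * expR (- u)| <= gamma_deriv_bound R m r u.
  move=> ly yr u0; rewrite /gamma_deriv_bound mulrA -mulrDl.
  rewrite normrM (ger0_norm (expR_ge0 _)) ler_pM2r ?expR_gt0// normrM.
  rewrite (ger0_norm (powR_ge0 _ _)).
  by apply: norm_ln_powR_le => //; [rewrite ml|]; exact: ltW.
have lxr : (`]l, r[ : set R) x by rewrite /= in_itv/= lx xr.
have intf y : (`]l, r[ : set R) y ->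
    mu.-integrable (`]0, +oo[ : set (measurableTypeR R)) (EFin \o f y).
  rewrite /= in_itv/= => /andP[ly yr].
  by apply: integrable_Gamma; exact: lt_trans ly.
have derf y u : (`]l, r[ : set R) y -> (`]0, +oo[ : set R) u ->
    derivable (f ^~ u) y 1.
  move=> _; rewrite /= in_itv/= andbT => u0.
  by have [] := is_derive_gamma_integrand_param _ y _ u0.
have G0 u : 0 <= gamma_deriv_bound R m r u.
  by rewrite addr_ge0 ?mulr_ge0 ?powR_ge0 ?expR_ge0// invr_ge0 ltW.
have Gub y u : (`]l, r[ : set R) y -> (`]0, +oo[ : set R) u ->
    `|partial1of2 f y u| <= gamma_deriv_bound R m r u.
  rewrite /= !in_itv/= andbT => /andP[ly yr] u0; rewrite d1E//; exact: fle.
have intG : mu.-integrable (`]0, +oo[ : set (measurableTypeR R))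
    (EFin \o gamma_deriv_bound R m r).
  exact: integrable_gamma_deriv_bound.
have m0y : measurable (`]0, +oo[ : set (measurableTypeR R)).
  exact: measurable_itv.
split; first by exact: (derivable_under_integral m0y lxr intf derf G0 intG Gub).
rewrite (differentiation_under_integral m0y lxr intf derf G0 intG Gub).
(* Measurability is read off from the explicit formula [d1E], continuous in [u] on the open
   half-line; the size is controlled by [Gub]. *)
have intd : mu.-integrable (`]0, +oo[ : set (measurableTypeR R))
    (EFin \o partial1of2 f x).
  apply: (le_integrable _ _ _ intG) => //.
    apply/measurable_EFinP.
    apply: (@eq_measurable_fun _ _ _ _ _
      (fun u => ln u * u `^ (x - 1) * expR (- u))).
      by move=> u; rewrite inE/= in_itv/= andbT => u0; rewrite d1E.
    apply: open_continuous_measurable_fun => // u.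
    rewrite inE/= in_itv/= andbT => u0.
    apply: cvgM; last first.
      by apply: continuous_comp; [exact: continuousN|exact: continuous_expR].
    apply: cvgM; last exact: continuous_powR.
    exact: continuous_ln.
  by move=> u u0 /=; rewrite lee_fin (le_trans (Gub _ _ lxr u0))// ler_norm.
apply: (le_trans (le_normr_Rintegral _ intd)) => //.
apply: le_Rintegral => //.
  exact: (integrable_norm intd).
by move=> u u0; exact: Gub.
Qed.

(** Restrict the integral to [[1, 2]], where [u^(x-1) >= u^(-1) >= 1/2] and
    [expR (- u) >= expR (- 2)]. The bound is uniform in [x], so it also controls [1 / Gamma x]. *)
Lemma Gamma_lower_bound (R : realType) (x : R) :
  0 < x -> expR (- 2) / 2 <= Gamma x.
Proof.
move=> x0; have ig : mu.-integrable (`]0, +oo[ : set (measurableTypeR R))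
    (EFin \o (fun u => u `^ (x - 1) * expR (- u))) by exact: integrable_Gamma.
have mI : measurable (`]0, +oo[ : set (measurableTypeR R)).
  exact: measurable_itv.
have mJ : measurable (`[1, 2] : set (measurableTypeR R)) by exact: measurable_itv.
have JI : (`[1, 2] : set R) `<=` (`]0, +oo[ : set R).
  move=> u /=; rewrite !in_itv/= andbT => /andP[u1 _]; exact: lt_le_trans u1.
have mg := measurable_int _ ig.
(* Convergence matters here: [fine] would turn an infinite integral into 0. *)
rewrite -lee_fin /Gamma /Rintegral fineK; last exact: (integrable_fin_num mI ig).
have g0 (u : R) : (0 <= (EFin \o (fun u => u `^ (x - 1) * expR (- u))%R) u)%E.
  by rewrite lee_fin mulr_ge0 ?powR_ge0 ?expR_ge0.
apply: (@le_trans _ _ (\int[mu]_(u in `[1%R, 2%R])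
    (u `^ (x - 1) * expR (- u))%:E)%E); last first.
  exact: (ge0_subset_integral mu mJ mI mg (fun u _ => g0 u) JI).
apply: (@le_trans _ _ (\int[mu]_(u in `[1%R, 2%R]) (expR (- 2) / 2)%:E)%E).
  rewrite integral_cst//= lebesgue_measure_itv/= lte_fin ltr1n -EFinB.
  by rewrite -EFinM lee_fin (_ : 2 - 1 = 1 :> R) ?mulr1//; ring.
apply: ge0_le_integral => //.
- exact: (measurable_funS mI JI mg).
- move=> u; rewrite /= in_itv/= => /andP[u1 u2]; rewrite lee_fin mulrC.
  have u0 : 0 < u by exact: lt_le_trans u1.
  apply: ler_pM; rewrite ?expR_ge0 ?invr_ge0 ?ler_expR ?lerN2//.
  apply: (@le_trans _ _ (u `^ (- 1))).
    by rewrite powR_inv1 ?(ltW u0)// lef_pV2 ?posrE.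
  by apply: ler_powR => //; lra.
Qed.

Lemma derivable_Gamma (R : realType) (x : R) :
  0 < x -> derivable (@Gamma R) x 1.
Proof.
move=> x0; have [M HM] := Gamma_deriv_bounded R (x / 2) (x + 1) ltac:(lra).
by have [] := HM x ltac:(lra) ltac:(lra).
Qed.

(** * The digamma function *)

(** Logarithmic derivative of the functional equation [GammaD1]. *)
Lemma digammaD1 (R : realType) (x : R) :
  0 < x -> digamma (x + 1) = digamma x + x^-1.
Proof.
move=> x0; have G0 : 0 < Gamma x.
  by apply: lt_le_trans (Gamma_lower_bound _ _ x0); rewrite divr_gt0 ?expR_gt0.
have x10 : 0 < x + 1 by rewrite addr_gt0.
pose g (y : R) : R := y + 1.
have d1 : is_derive x 1 g 1.
  apply: (is_derive_eq (is_deriveD (is_derive_id x 1)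
    (is_derive_cst (1 : R) x 1))).
  by rewrite addr0.
have dG1 : is_derive (g x) 1 (@Gamma R) (derive1 (@Gamma R) (x + 1)).
  by rewrite derive1E; apply: derivableP; exact: derivable_Gamma.
have dG : is_derive x 1 (@Gamma R) (derive1 (@Gamma R) x).
  by rewrite derive1E; apply: derivableP; exact: derivable_Gamma.
have [_ E1] := is_derive1_comp dG1 d1.
have [_ E2] := is_deriveM (is_derive_id x 1) dG.
have E : 'D_1 (@Gamma R \o g) x = 'D_1 (id * @Gamma R) x.
  (* The functional equation is available only for positive arguments, so the two functions are
     compared near [x]. *)
  apply: near_eq_derive; near=> y.
  by rewrite fctE/= /g GammaD1//; near: y; exact: lt_nbhsr.
move: E; rewrite E1 E2 mulr1 /GRing.scale/= mulr1 => E.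
rewrite /digamma GammaD1// E; field.
by rewrite !gt_eqF.
Unshelve. all: end_near. Qed.

(** The numerator is bounded on the interval and the denominator stays away from 0. *)
Lemma digamma_bounded (R : realType) (l r : R) : 0 < l ->
  exists M : R, forall x, l < x -> x < r -> `|digamma x| <= M.
Proof.
move=> l0; have [M HM] := Gamma_deriv_bounded R l r l0.
exists (M / (expR (- 2) / 2)) => x lx xr; have [_ Mx] := HM x lx xr.
have c0 : 0 < expR (- 2) / 2 :> R by rewrite divr_gt0 ?expR_gt0.
have Gc := Gamma_lower_bound _ _ (lt_trans l0 lx).
have G0 := lt_le_trans c0 Gc.
rewrite /digamma normrM normfV (gtr0_norm G0).
by apply: ler_pM; rewrite ?normr_ge0 ?invr_ge0 ?(ltW G0)// lef_pV2 ?posrE.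
Qed.

(** * From complete monotonicity to the bound on the exponent *)

(** Order 0 of the hypothesis supplies differentiability, order 1 a nonpositive derivative. *)
Lemma completely_monotone_nincr (R : realType) (a : R) (f : R -> R) :
  completely_monotone `]a, +oo[%R f ->
  forall x y, a < x -> x <= y -> f y <= f x.
Proof.
move=> cm x y ax xy.
have Ia u : x <= u -> u \in `]a, +oo[%R.
  by move=> xu; rewrite in_itv/= andbT (lt_le_trans ax).
have df u : x <= u -> derivable f u 1 by move=> /Ia/(cm 0%N)[].
apply: (@ler0_derive1_nincry _ f x) => // [u|u|].
- by rewrite in_itv/= andbT => /ltW /df.
- rewrite in_itv/= andbT => /ltW/Ia/(cm 1%N)[_].
  by rewrite expr1 mulN1r oppr_ge0.
- apply: derivable_within_continuous => u.
  by rewrite in_itv/= andbT; exact: df.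
Qed.

Local Close Scope classical_set_scope.

Theorem mainTheorem2 (R : realType) (a b alpha beta : R)
  (ha : 0 <= a) (hb : 0 <= b) (hab : 0 < 1 - b + a < 1)
  (hbeta : beta = b - a)
  (hcm : completely_monotone `]- a, +oo[
     (fun x : R => (x + a) `^ alpha *
        (digamma (x + b) - digamma (x + a) - beta / (x + a))))
  (hpos : 0 < - 1 - 2 * a + 2 * b) :
  alpha < 2.
Proof.
rewrite ltNge; apply/negP => alpha2.
set f := fun x : R => _ in hcm.
have {hab} [s0 s1] : 0 < beta /\ beta < 1 by move: hab => /andP[]; lra.
(* For [0 < t < 1] both [t + beta] and [t + 1] lie strictly between [beta] and 3, away from the pole
   at 0. *)
have [M HM] := digamma_bounded R beta 3 s0.
have fE t : 0 < t -> f (t - a) =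
    t `^ (alpha - 1) * (1 - beta + t * (digamma (t + beta) - digamma (t + 1))).
  move=> t0; rewrite /f subrK digammaD1// (_ : t - a + b = t + beta).
    rewrite -(mulr_powRB1 (ltW t0) (_ : 0 < alpha)); last by lra.
    by field; rewrite gt_eqF.
  by rewrite hbeta; ring.
have fM t : 0 < t -> t < 1 ->
    `|digamma (t + beta) - digamma (t + 1)| <= 2 * M.
  move=> t0 t1; apply: (le_trans (ler_normB _ _)).
  by rewrite (mulr_natl M 2) mulr2n lerD// HM//; lra.
have M0 : 0 <= M.
  by have := fM (1 / 2) ltac:(lra) ltac:(lra);
     have := normr_ge0 (digamma (1 / 2 + beta) - digamma (1 / 2 + 1)); lra.
(* [2 M t0 < 1 - beta] makes the bracket in [fE] positive at [t0]. *)
pose t0 := (1 - beta) / (2 * M + 2).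
have K0 : 0 < 2 * M + 2 by lra.
have t0_gt0 : 0 < t0 by rewrite divr_gt0// subr_gt0.
have t0K : t0 * (2 * M + 2) = 1 - beta by rewrite divfK// gt_eqF.
(* The summand 2 in [2 * M + 2] works here: [t0 * (2 * M + 2) = 1 - beta < 1] and
   [2 * M + 2 >= 2]. *)
have t0_lt1 : t0 < 1 by nra.
have f0 : 0 < f (t0 - a).
  rewrite fE// mulr_gt0 ?powR_gt0//.
  have := fM _ t0_gt0 t0_lt1; rewrite ler_norml => /andP[+ _].
  by set d := _ - _ => dM; nra.
(* The point [t] lies left of [t0], so monotonicity would give [f (t0 - a) <= f (t - a)]. Its second
   bound is set to contradict this through [f (t - a) <= t * (2 * M + 2)]; the extra factor 2 makes
   the inequality strict. *)
pose t := Num.min t0 (f (t0 - a) / (2 * (2 * M + 2))).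
have t_gt0 : 0 < t.
  by rewrite /t lt_min t0_gt0 divr_gt0// mulr_gt0.
have t_le : t <= t0 by rewrite /t ge_min lexx.
have t_lt1 : t < 1 by exact: le_lt_trans t_le t0_lt1.
have tf : t * (2 * (2 * M + 2)) <= f (t0 - a).
  by rewrite -ler_pdivlMr ?mulr_gt0// /t ge_min lexx orbT.
have := completely_monotone_nincr _ _ _ hcm (t - a) (t0 - a).
have -> : - a < t - a by lra.
have -> : t - a <= t0 - a by lra.
move=> /(_ isT isT); rewrite leNgt => /negP; apply.
apply: lt_le_trans tf; rewrite fE//.
have := fM _ t_gt0 t_lt1; rewrite ler_norml => /andP[_].
set d := _ - _ => dM.
apply: (@le_lt_trans _ _ (t * (2 * M + 2))); last by nra.
(* The bracket in [fE] is at most [1 + 2 * M]. Then [t^(alpha-1) <= t], because [t < 1] and the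
   assumption [2 <= alpha] makes the exponent at least 1. *)
apply: (@le_trans _ _ (t `^ (alpha - 1) * (2 * M + 2))).
  by rewrite ler_wpM2l ?powR_ge0//; nra.
rewrite ler_wpM2r ?(ltW K0)//.
by apply: ge1r_powR; [rewrite t_gt0 ltW|lra].
Qed.
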